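(* Let $R$ be a ring and let $M$ be a finitely generated quasi-projective right $R$-module. The following conditions are equivalent: (a) $M$ is abelian endoregular and a generator of $\sigma[M]$. (b) $M$ is co-semisimple and quasi-duo. (c) $M$ is duo and a generator of $\sigma[M]$, and every cyclic submodule of $M$ is a direct summand of $M$.
   Context: Rings are associative with identity and modules are unitary right modules. A ring $S$ is von Neumann regular if for every $s\in S$ there is $x\in S$ with $sxs=s$; it is abelian if every idempotent of $S$ is central. $M$ is abelian endoregular if $\operatorname{End}_R(M)$ is abelian von Neumann regular. $M$ is quasi-projective if for every epimorphism $\pi:M\to N$ and every homomorphism $f:M\to N$ there is $g\in\operatorname{End}_R(M)$ with $\pi g=f$. A module is $M$-generated if it is an epimorphic image of $M^{(\mathcal I)}$ for some index set $\mathcal I$, and $\sigma[M]$ is the full subcategory of the category of right $R$-modules consisting of all modules that are isomorphic to submodules of $M$-generated modules. $M$ is a generator of $\sigma[M]$ if every module in $\sigma[M]$ is $M$-generated. A module $N$ is $M$-injective if for every monomorphism $\eta:K\to M$ and every homomorphism $f:K\to N$ there is $g:M\to N$ with $g\eta=f$. $M$ is co-semisimple if every simple module (in $\sigma[M]$) is $M$-injective. A submodule $N$ of $M$ is fully invariant if $\varphi(N)\subseteq N$ for all $\varphi\in\operatorname{End}_R(M)$; $M$ is duo (resp. quasi-duo) if every submodule (resp. every maximal submodule) of $M$ is fully invariant. *)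

(* Defs.v *)
From HB Require Import structures.
From mathcomp Require Import all_boot all_algebra.
From mathcomp Require Import boolp classical_sets functions cardinality.

Set Implicit Arguments.
Unset Strict Implicit.
Unset Printing Implicit Defensive.

Import GRing.Theory.
Local Open Scope classical_set_scope.
Local Open Scope ring_scope.

(* MathComp modules are left modules.  A right module over R is a left module *)
(* over the converse ring R^c: for M : rmodType R, the element [a *: m] is    *)
(* the right action of a on m.  The notions below are stated for modules over *)
(* an arbitrary ring A and are used with A := R^c.                            *)
Notation rmodType R := (lmodType R^c).

Definition von_neumann_regular (S : pzRingType) : Prop :=
  forall s : S, exists x : S, s * x * s = s.

Definition abelian_ring (S : pzRingType) : Prop :=
  forall e : S, e * e = e -> forall x : S, e * x = x * e.

(* The endomorphism ring: pointwise addition, and (f * g) m = f (g m). *)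
Definition endo (A : pzRingType) (M : lmodType A) : Type := {linear M -> M}.

Section EndoRing.
Variables (A : pzRingType) (M : lmodType A).
Implicit Types f g h : endo M.

HB.instance Definition _ := gen_eqMixin (endo M).
HB.instance Definition _ := gen_choiceMixin (endo M).

Definition endo_zero : endo M := [the {linear M -> M} of \0].
Definition endo_opp f : endo M := [the {linear M -> M} of \- (f : {linear M -> M})].
Definition endo_add f g : endo M :=
  [the {linear M -> M} of (f : {linear M -> M}) \+ (g : {linear M -> M})].
Definition endo_one : endo M := [the {linear M -> M} of idfun].
Definition endo_mul f g : endo M :=
  [the {linear M -> M} of (f : {linear M -> M}) \o (g : {linear M -> M})].

Lemma endoP f g : (f : {linear M -> M}) =1 (g : {linear M -> M}) -> f = g.
Proof.
move: f g => [f cf] [g cg] /= /funext fg; case: _ / fg cg => cg.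
case: cf cg => [[fA] [fZ]] [[gA] [gZ]].
by rewrite (Prop_irrelevance fA gA) (Prop_irrelevance fZ gZ).
Qed.

Lemma endo_addA : associative endo_add.
Proof. by move=> f g h; apply: endoP => x /=; rewrite addrA. Qed.
Lemma endo_addC : commutative endo_add.
Proof. by move=> f g; apply: endoP => x /=; rewrite addrC. Qed.
Lemma endo_add0 : left_id endo_zero endo_add.
Proof. by move=> f; apply: endoP => x /=; rewrite add0r. Qed.
Lemma endo_addN : left_inverse endo_zero endo_opp endo_add.
Proof. by move=> f; apply: endoP => x /=; rewrite addNr. Qed.
Lemma endo_mulA : associative endo_mul.
Proof. by move=> f g h; apply: endoP. Qed.
Lemma endo_mul1 : left_id endo_one endo_mul.
Proof. by move=> f; apply: endoP. Qed.
Lemma endo_mulr1 : right_id endo_one endo_mul.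
Proof. by move=> f; apply: endoP. Qed.
Lemma endo_mulDl : left_distributive endo_mul endo_add.
Proof. by move=> f g h; apply: endoP. Qed.
Lemma endo_mulDr : right_distributive endo_mul endo_add.
Proof. by move=> f g h; apply: endoP => x /=; rewrite raddfD. Qed.

HB.instance Definition _ := GRing.isPzRing.Build (endo M)
  endo_addA endo_addC endo_add0 endo_addN
  endo_mulA endo_mul1 endo_mulr1 endo_mulDl endo_mulDr.
End EndoRing.

(* The direct sum M^(I): families I -> M with finite support, as a submodule  *)
(* of the module I -> M with pointwise operations.                            *)
Definition fin_supp (A : pzRingType) (I : Type) (M : lmodType A) : {pred I -> M} :=
  fun f => `[< finite_set [set i | f i != 0] >].

Lemma fin_supp_submod (A : pzRingType) (I : Type) (M : lmodType A) :
  submod_closed (@fin_supp A I M).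
Proof.
split=> [|a f g].
  apply/asboolP; rewrite (_ : [set _ | _] = set0) ?finite_set0 //.
  by apply/seteqP; split=> i //=; rewrite eqxx.
move=> /asboolP ff /asboolP fg; apply/asboolP.
apply: (@sub_finite_set _ _ ([set i | f i != 0] `|` [set i | g i != 0])).
  move=> i /= nz; apply: contrapT => /not_orP[] /negP/negPn/eqP f0.
  move=> /negP/negPn/eqP g0; move: nz.
  by rewrite [X in X != 0](_ : _ = a *: f i + g i) // f0 g0 scaler0 addr0 eqxx.
by rewrite finite_setU.
Qed.

HB.instance Definition _ (A : pzRingType) (I : Type) (M : lmodType A) :=
  GRing.isSubmodClosed.Build A (I -> M) (@fin_supp A I M)
    (GRing.submod_closed_semi (fin_supp_submod I M)).

Record dsum (A : pzRingType) (I : Type) (M : lmodType A) := DSum {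
  dsum_val :> I -> M;
  _ : dsum_val \in @fin_supp A I M
}.

HB.instance Definition _ (A : pzRingType) (I : Type) (M : lmodType A) :=
  [isSub for @dsum_val A I M].
HB.instance Definition _ (A : pzRingType) (I : Type) (M : lmodType A) :=
  [Choice of dsum I M by <:].
HB.instance Definition _ (A : pzRingType) (I : Type) (M : lmodType A) :=
  [SubChoice_isSubLmodule of dsum I M by <:].

Definition surjective (T U : Type) (f : T -> U) : Prop :=
  forall y, exists x, f x = y.

Section ModuleNotions.
Variable A : pzRingType.
Implicit Types M N K G : lmodType A.

Definition submodule M (N : set M) : Prop := submod_closed [in N].

Definition finitely_generated M : Prop :=
  exists (n : nat) (e : 'I_n -> M),
    forall m : M, exists c : 'I_n -> A, m = \sum_(i < n) c i *: e i.

Definition quasi_projective M : Prop :=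
  forall N (p : {linear M -> N}) (f : {linear M -> N}), surjective p ->
    exists g : {linear M -> M}, p \o g =1 f.

Definition abelian_endoregular M : Prop :=
  von_neumann_regular (endo M) /\ abelian_ring (endo M).

Definition generated_by M N : Prop :=
  exists (I : Type) (f : {linear dsum I M -> N}), surjective f.

(* N is an object of sigma[M]: N is isomorphic (via f) to a submodule H of an *)
(* M-generated module G.                                                      *)
Definition in_sigma M N : Prop :=
  exists2 G, generated_by M G &
    exists2 H : set G, submodule H &
      exists f : {linear N -> G}, injective f /\ range f = H.

Definition generator_of_sigma M : Prop :=
  forall N, in_sigma M N -> generated_by M N.

(* N is M-injective. *)
Definition relatively_injective M N : Prop :=
  forall K (eta : {linear K -> M}) (f : {linear K -> N}), injective eta ->
    exists g : {linear M -> N}, g \o eta =1 f.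

Definition simple_module N : Prop :=
  (exists x : N, x != 0) /\
  forall H : set N, submodule H -> H = [set 0] \/ H = [set: N].

Definition co_semisimple M : Prop :=
  forall N, simple_module N -> in_sigma M N -> relatively_injective M N.

Definition fully_invariant M (N : set M) : Prop :=
  forall f : {linear M -> M}, f @` N `<=` N.

Definition maximal_submodule M (N : set M) : Prop :=
  [/\ submodule N, N <> [set: M] &
      forall H : set M, submodule H -> N `<=` H -> H = N \/ H = [set: M]].

Definition duo M : Prop :=
  forall N : set M, submodule N -> fully_invariant N.

Definition quasi_duo M : Prop :=
  forall N : set M, maximal_submodule N -> fully_invariant N.

Definition cyclic_submodule M (m : M) : set M := [set a *: m | a in [set: A]].

Definition direct_summand M (N : set M) : Prop :=
  submodule N /\
  exists H : set M, [/\ submodule H, N `&` H = [set 0] &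
    [set x + y | x in N & y in H] = [set: M]].

End ModuleNotions.

(* Main.v *)
Require Import Defs.
From HB Require Import structures.
From mathcomp Require Import all_boot all_algebra.
From mathcomp Require Import boolp classical_sets functions cardinality fsbigop.

(* (a) => (c): a cyclic submodule is M-generated, hence a finite sum of images
   of endomorphisms, and over an abelian regular ring such a sum is the image of
   a central idempotent; submodules of that form are fully invariant summands.

   (c) => (b): let f : K -> N be nonzero with K <= M and N simple, pick k in K
   with f k <> 0 and let e be the projection onto the cyclic submodule of k,
   central because M is duo.  Then f e extends f: if f k'' <> 0 with e k'' = 0,
   a projection e'' onto the submodule of k'' and quasi-projectivity give
   f e h = f e'', and evaluation at k'' contradicts e h = h e.

   (b) => (a): by Zorn and injectivity of simple modules, every submodule of M
   is an intersection of maximal submodules, so M is duo and the idempotent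
   endomorphisms are central.  If P is maximal and f P <= P then f (f y) in P
   forces f y in P, so the same holds for every submodule; hence
   f M = f (f M), f M meets ker f trivially, and lifting f through f f gives
   f g f = f.  For the generator property, suppose N <= G in sigma[M] is not
   M-generated.  A simple subquotient N'/L of N, with L containing the trace of
   M, is a nonzero image of M by injectivity, and M -> N'/L lifts to M -> N
   because quasi-projectivity extends to quotients of finite powers of M; this
   contradicts the choice of L. *)

Set Implicit Arguments.
Unset Strict Implicit.
Unset Printing Implicit Defensive.

Import GRing.Theory.
Local Open Scope classical_set_scope.
Local Open Scope ring_scope.

(** * Submodules and linear maps *)

Section Submodules.
Variable A : pzRingType.
Implicit Types M N G H : lmodType A.

Lemma linear_ex M N (f : M -> N) : linear f ->
  exists g : {linear M -> N}, g =1 f.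
Proof.
move=> lf; pose fL := GRing.isLinear.Build A M N *:%R f lf.
by exists (HB.pack f fL : {linear M -> N}).
Qed.

Lemma submoduleP M (N : set M) :
  submodule N <-> N 0 /\ forall a x y, N x -> N y -> N (a *: x + y).
Proof.
split=> [[N0 Nlin]|[N0 Nlin]]; split.
- by move: N0; rewrite inE.
- by move=> a x y Nx Ny; have := Nlin a x y; rewrite !inE; apply.
- by rewrite inE.
- by move=> a x y; rewrite !inE; apply: Nlin.
Qed.

Section Closure.
Variables (M : lmodType A) (N : set M).
Hypothesis Nsub : submodule N.

Lemma submodule0 : N 0.
Proof. by have /submoduleP[] := Nsub. Qed.

Lemma submoduleZ a x : N x -> N (a *: x).
Proof.
move=> Nx; have /submoduleP[N0 Nlin] := Nsub.
by rewrite -[_ *: _]addr0; apply: Nlin.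
Qed.

Lemma submoduleD x y : N x -> N y -> N (x + y).
Proof.
move=> Nx Ny; have /submoduleP[_ Nlin] := Nsub.
by rewrite -[x]scale1r; apply: Nlin.
Qed.

Lemma submoduleN x : N x -> N (- x).
Proof. by rewrite -scaleN1r; apply: submoduleZ. Qed.

Lemma submoduleB x y : N x -> N y -> N (x - y).
Proof. by move=> Nx Ny; apply: submoduleD => //; apply: submoduleN. Qed.

Lemma submodule_subl x y : N (x - y) -> N y -> N x.
Proof. by move=> Nxy Ny; rewrite -(subrK y x); apply: submoduleD. Qed.

End Closure.

Lemma submodule_cyclic M (m : M) : submodule (cyclic_submodule m).
Proof.
apply/submoduleP; split; first by exists 0; rewrite ?scale0r.
move=> a _ _ [b _ <-] [c _ <-]; exists (a * b + c) => //.
by rewrite scalerDl scalerA.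
Qed.

Lemma cyclic_gen M (m : M) : cyclic_submodule m m.
Proof. by exists 1; rewrite ?scale1r. Qed.

Lemma cyclic_subset M (N : set M) m :
  submodule N -> N m -> cyclic_submodule m `<=` N.
Proof. by move=> Nsub Nm _ [a _ <-]; apply: submoduleZ. Qed.

Lemma submodule_set0 M : submodule ([set 0] : set M).
Proof.
by apply/submoduleP; split=> // a _ _ -> ->; rewrite /= scaler0 addr0.
Qed.

Lemma submoduleT M : submodule [set: M].
Proof. exact/submoduleP. Qed.

Lemma submodule_preimage M N (f : {linear M -> N}) (W : set N) :
  submodule W -> submodule (f @^-1` W).
Proof.
move=> Wsub; apply/submoduleP; split=> [|a x y Wx Wy] /=.
  by rewrite linear0; apply: submodule0.
by rewrite linearP; apply: submoduleD => //; apply: submoduleZ.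
Qed.

Lemma submodule_image M N (f : {linear M -> N}) (W : set M) :
  submodule W -> submodule (f @` W).
Proof.
move=> Wsub; apply/submoduleP; split.
  by exists 0; [apply: submodule0 | rewrite linear0].
move=> a _ _ [x Wx <-] [y Wy <-]; exists (a *: x + y); last by rewrite linearP.
by apply: submoduleD => //; apply: submoduleZ.
Qed.

(** Preimages under an injective [j] are unique, so choosing them pointwise is automatically
    linear. *)
Lemma linear_factor M N G (j : {linear N -> G}) (h : {linear M -> G}) :
  injective j -> range h `<=` range j ->
  exists g : {linear M -> N}, j \o g =1 h.
Proof.
move=> jinj hj.
have /choice[g gE] : forall m, exists n, j n = h m.
  by move=> m; have [|n _ nE] := hj (h m); [exists m | exists n].
have [|g' g'E] := @linear_ex M N g; last by exists g' => m /=; rewrite g'E.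
by move=> a x y; apply: jinj; rewrite linearP !gE linearP.
Qed.

End Submodules.

(** * Submodules as modules in their own right *)

Section SubmoduleType.
Variables (A : pzRingType) (M : lmodType A) (N : set M).
Hypothesis Nsub : submodule N.

Let carrier : {pred M} := [in N].
#[local] HB.instance Definition _ := GRing.isSubmodClosed.Build A M carrier
  (GRing.submod_closed_semi Nsub).
Let subT := {x : M | x \in carrier}.
#[local] HB.instance Definition _ := [isSub for (@sval M _ : subT -> M)].
#[local] HB.instance Definition _ := [Choice of subT by <:].
#[local] HB.instance Definition _ := [SubChoice_isSubLmodule of subT by <:].

Lemma submodule_type : exists (K : lmodType A) (i : {linear K -> M}),
  injective i /\ range i = N.
Proof.
exists subT, (val : {linear subT -> M}); split; first exact: val_inj.
apply/seteqP; split=> [_ [x _ <-]|x Nx].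
  by have := valP x; rewrite /carrier inE.
have xN : x \in carrier by rewrite inE.
by exists (exist _ x xN).
Qed.

End SubmoduleType.

(** * Quotient modules *)

Section QuotientType.
Variables (A : pzRingType) (M : lmodType A) (N : set M).
Hypothesis Nsub : submodule N.

(** One element is chosen in each coset, and the quotient consists of these representatives.
    Congruent elements define the same set, so [xget] picks the same point; the default 0 never
    occurs, since [x] lies in its own coset. *)
Let rep (x : M) : M := xget 0 [set y | N (x - y)].

Let repP x : N (x - rep x).
Proof.
apply: (@xgetI _ 0 [set y | N (x - y)] x).
by rewrite /= subrr; apply: submodule0.
Qed.

Let rep_eq x y : N (x - y) -> rep x = rep y.
Proof.
move=> Nxy; rewrite /rep; congr xget; apply/seteqP; split=> z /= Nz.
  rewrite -(addrNK x y) -addrA -opprB.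
  by apply: submoduleD => //; apply: submoduleN.
by rewrite -(addrNK y x) -addrA; apply: submoduleD.
Qed.

Let repK x : rep (rep x) = rep x.
Proof. exact/esym/rep_eq. Qed.

Let quoT := {x : M | rep x == x}.
#[local] HB.instance Definition _ := [isSub for (@sval M _ : quoT -> M)].
#[local] HB.instance Definition _ := [Choice of quoT by <:].
Let pr (x : M) : quoT :=
  exist (fun x => rep x == x) (rep x) (introT eqP (repK x)).

Let pr_eq x y : N (x - y) -> pr x = pr y.
Proof. by move=> Nxy; apply: val_inj; apply: rep_eq. Qed.

Let prK (x : quoT) : pr (val x) = x.
Proof. by apply: val_inj; apply/eqP; apply: (valP x). Qed.

Let qadd (x y : quoT) := pr (val x + val y).
Let qopp (x : quoT) := pr (- val x).
Let qscale a (x : quoT) := pr (a *: val x).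

Let pr_add x y : qadd (pr x) (pr y) = pr (x + y).
Proof.
apply/esym/pr_eq; rewrite opprD addrACA.
by apply: submoduleD => //; apply: repP.
Qed.

Let pr_opp x : qopp (pr x) = pr (- x).
Proof.
by apply/esym/pr_eq; rewrite -opprD; apply: submoduleN => //; apply: repP.
Qed.

Let pr_scale a x : qscale a (pr x) = pr (a *: x).
Proof.
by apply/esym/pr_eq; rewrite -scalerBr; apply: submoduleZ => //; apply: repP.
Qed.

Let qaddA : associative qadd.
Proof.
by move=> x y z; rewrite -(prK x) -(prK y) -(prK z) !pr_add addrA.
Qed.
Let qaddC : commutative qadd.
Proof. by move=> x y; rewrite -(prK x) -(prK y) !pr_add addrC. Qed.
Let qadd0 : left_id (pr 0) qadd.
Proof. by move=> x; rewrite -(prK x) pr_add add0r. Qed.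
Let qaddN : left_inverse (pr 0) qopp qadd.
Proof. by move=> x; rewrite -(prK x) pr_opp pr_add addNr. Qed.
#[local] HB.instance Definition _ :=
  GRing.isZmodule.Build quoT qaddA qaddC qadd0 qaddN.

Let qscaleA a b x : qscale a (qscale b x) = qscale (a * b) x.
Proof. by rewrite -(prK x) !pr_scale scalerA. Qed.
Let qscale1 : left_id 1 qscale.
Proof. by move=> x; rewrite -(prK x) pr_scale scale1r. Qed.
Let qscaleDr : right_distributive qscale +%R.
Proof.
move=> a x y; rewrite -(prK x) -(prK y).
by rewrite [in LHS]/+%R /= pr_add !pr_scale [in RHS]/+%R /= pr_add scalerDr.
Qed.
Let qscaleDl x : {morph qscale^~ x : a b / a + b}.
Proof.
move=> a b; rewrite -(prK x) !pr_scale.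
by rewrite [in RHS]/+%R /= pr_add scalerDl.
Qed.
#[local] HB.instance Definition _ :=
  GRing.Zmodule_isLmodule.Build A quoT qscaleA qscale1 qscaleDr qscaleDl.

Lemma quotient_type : exists (H : lmodType A) (p : {linear M -> H}),
  surjective p /\ forall x, p x = 0 <-> N x.
Proof.
have [|p pE] := @linear_ex A M quoT pr.
  move=> a x y; rewrite -pr_add -pr_scale.
  by [].
exists quoT, p; split=> [y|x]; first by exists (val y); rewrite pE prK.
rewrite pE; split=> [px0|Nx]; last by apply: pr_eq; rewrite subr0.
have /(congr1 val) /= px : pr x = pr 0 by [].
apply: (submodule_subl Nsub (repP x)); rewrite px.
(* The representative of the zero coset may differ from 0, but it lies in [N]. *)
by rewrite -(subKr 0 (rep 0)) sub0r; apply: submoduleN.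
Qed.

End QuotientType.

(** * Sums of images, traces and generated modules *)

Section Generation.
Variable A : pzRingType.
Implicit Types M N G H : lmodType A.

Fixpoint sum_ranges M N (s : seq {linear M -> N}) : set N :=
  if s is u :: s' then [set x + y | x in range u & y in sum_ranges s']
  else [set 0].

(** The sum of all images of [M] in [N]. By [generated_byP], generation can be handled through it
    without direct sums. *)
Definition trace M N : set N :=
  [set x | exists s : seq {linear M -> N}, sum_ranges s x].
#[local] Arguments trace M N _ : clear implicits.

Lemma submodule_sum_ranges M N (s : seq {linear M -> N}) :
  submodule (sum_ranges s).
Proof.
elim: s => [|u s IHs] /=; first exact: submodule_set0.
apply/submoduleP; split.
  exists 0; first by exists 0; rewrite ?linear0.
  by exists 0; [apply: submodule0 | rewrite addr0].
move=> a _ _ [_ [x1 _ <-] [y1 sy1 <-]] [_ [x2 _ <-] [y2 sy2 <-]].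
exists (u (a *: x1 + x2)); first by exists (a *: x1 + x2).
exists (a *: y1 + y2).
  by apply: submoduleD => //; apply: submoduleZ.
by rewrite linearP scalerDr addrACA.
Qed.

Lemma sum_ranges_cat M N (s t : seq {linear M -> N}) x y :
  sum_ranges s x -> sum_ranges t y -> sum_ranges (s ++ t) (x + y).
Proof.
elim: s x => [|u s IHs] x /=; first by move=> ->; rewrite add0r.
move=> [x1 ux1 [x2 sx2 <-]] ty; exists x1 => //; exists (x2 + y).
  exact: IHs.
by rewrite addrA.
Qed.

Lemma submodule_trace M N : submodule (trace M N).
Proof.
apply/submoduleP; split=> [|a x y [s sx] [t ty]]; first by exists [::].
exists (s ++ t); apply: sum_ranges_cat => //.
by apply: submoduleZ => //; apply: submodule_sum_ranges.
Qed.

Lemma range_trace M N (u : {linear M -> N}) : range u `<=` trace M N.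
Proof.
by move=> x ux; exists [:: u]; exists x => //; exists 0; rewrite ?addr0.
Qed.

Lemma sum_ranges_comp M N G (j : {linear N -> G}) (s : seq {linear M -> N}) :
  sum_ranges [seq [the {linear M -> G} of j \o u] | u : {linear M -> N} <- s] =
  j @` sum_ranges s.
Proof.
elim: s => [|u s /= ->] /=; first by rewrite image_set1 linear0.
apply/seteqP.
split=> [_ [_ [m _ <-] [_ [y sy <-] <-]]|_ [_ [_ [m _ <-] [y sy <-]] <-]].
  exists (u m + y); last by rewrite linearD.
  by exists (u m); [exists m | exists y].
exists (j (u m)); first by exists m.
by exists (j y); [exists y | rewrite linearD].
Qed.

Section Single.
Variables (I : Type) (M : lmodType A).

Let single_fun (i : I) (m : M) : I -> M :=
  fun k => if `[< k = i >] then m else 0.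

Let single_fin i m : single_fun i m \in @fin_supp A I M.
Proof.
apply/asboolP/(@sub_finite_set _ _ [set i]); last exact: finite_set1.
by move=> k /=; rewrite /single_fun; case: asboolP => //; rewrite eqxx.
Qed.

Lemma single_ex i : exists u : {linear M -> dsum I M},
  forall m k, dsum_val (u m) k = if `[< k = i >] then m else 0.
Proof.
have [|u uE] := @linear_ex A M (dsum I M) (fun m => DSum (single_fin i m)).
  move=> a x y; apply: val_inj; apply/funext => k /=.
  rewrite [RHS](_ : _ = a *: single_fun i x k + single_fun i y k) //.
  by rewrite /single_fun; case: asboolP; rewrite ?scaler0 ?addr0.
by exists u => m k; rewrite uE.
Qed.

(** A finitely supported family is the finite sum of its one-coordinate components, each in the
    image of some map from [M]. *)
Lemma dsum_ind (W : set (dsum I M)) : submodule W ->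
  (forall u : {linear M -> dsum I M}, range u `<=` W) -> W = setT.
Proof.
move=> Wsub Wu; apply/seteqP; split=> // d _.
have dfin : finite_set [set i | d i != 0] by apply/asboolP; case: d.
have [s sE] : exists s : seq {classic I},
    forall i : I, d i != 0 -> (i : {classic I}) \in s.
  have /(@finite_seqP {classic I})[s sE] := dfin.
  by exists s => i di; have : [set i | d i != 0] i by []; rewrite sE.
(* The list only has to cover the support, so after removal of the component at its head the tail
   still covers what remains. *)
elim: s d {dfin} sE => [|i s IHs] d sE.
  rewrite (_ : d = 0); first exact: submodule0.
  apply: val_inj; apply/funext => i /=; apply/eqP/negPn/negP.
  by move=> /sE.
have [u uE] := single_ex i.
have Wui : W (u (d i)) by apply: (Wu u); exists (d i).
apply: (submodule_subl Wsub _ Wui); apply: IHs => k.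
have -> : dsum_val (d - u (d i)) k = d k - u (d i) k by [].
rewrite uE.
case: asboolP => [->|ki]; first by rewrite subrr eqxx.
rewrite subr0 => /sE; rewrite inE => /predU1P[//|//].
Qed.

End Single.

(** Index the direct sum by the maps themselves and send a family [d] to the sum of the values
    [u (d u)]. *)
Lemma dsum_sum_ex M N : exists f : {linear dsum {linear M -> N} M -> N},
  forall u : {linear M -> N}, range u `<=` range f.
Proof.
pose I := {classic {linear M -> N}}.
pose supp (d : dsum {linear M -> N} M) : set I := [set u | d u != 0].
have sfin d : finite_set (supp d) by apply/asboolP; case: d.
pose F (d : dsum {linear M -> N} M) : N :=
  \sum_(u \in supp d) (u : {linear M -> N}) (d u).
(* Supports vary with the family; enlarging the index set does not change the sum, so linearity can
   be checked over a common one. *)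
have FE d (D : set I) : supp d `<=` D ->
    F d = \sum_(u \in D) (u : {linear M -> N}) (d u).
  move=> dD; apply: fsbig_widen => // u [_ /negP/negPn/eqP /= ->].
  exact: linear0.
have [|f fE] := @linear_ex A _ N F.
  move=> a x y; pose D := supp x `|` supp y.
  have Dfin : finite_set D by rewrite finite_setU.
  rewrite (FE x D) ?(FE y D); [|by move=> ? ?; right|by move=> ? ?; left].
  rewrite (FE _ D).
    rewrite !fsbig_finite// scaler_sumr -big_split /=.
    apply: eq_bigr => u _; rewrite -linearP; congr (_ _).
  move=> u /= nz; apply: contrapT => /not_orP[] /negP/negPn/eqP x0.
  move=> /negP/negPn/eqP y0; move/eqP: nz; apply.
  by transitivity (a *: x u + y u); last rewrite x0 y0 scaler0 addr0.
exists f => u _ [m _ <-]; have [v vE] := @single_ex {linear M -> N} M u.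
exists (v m) => //; rewrite fE (FE _ [set (u : I)]).
  have vu : v m u = m by rewrite vE; case: asboolP.
  by rewrite fsbig_set1; apply: (congr1 u vu).
by move=> w /= /eqP; have := vE m w; case: asboolP.
Qed.

Lemma generated_byP M N : generated_by M N <-> trace M N = setT.
Proof.
split=> [[I [f fsurj]]|tT].
  apply/seteqP; split=> // y _; have [d <-] := fsurj y.
  suff tf d' : trace M N (f d') by apply: tf.
  have := @dsum_ind I M (f @^-1` trace M N).
  move=> /(_ (submodule_preimage f (submodule_trace M N))) WT.
  have : [set: dsum I M] d' by []; rewrite -WT // => u _ [m _ <-].
  by apply: (@range_trace _ _ [the {linear M -> N} of f \o u]); exists m.
have [f fE] := dsum_sum_ex M N; exists {linear M -> N}, f => y.
have fsub : submodule (range f) by apply: submodule_image; apply: submoduleT.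
suff [d _ <-] : range f y by exists d.
have : trace M N y by rewrite tT.
move=> [s]; elim: s y => [|u s IHs] y /=.
  by move=> ->; apply: (submodule0 fsub).
by move=> [x ux [z /IHs sz <-]]; apply: (submoduleD fsub) => //; apply: (fE u).
Qed.

Lemma generated_by_self M : generated_by M M.
Proof.
apply/generated_byP/seteqP; split=> // m _.
by apply: (@range_trace _ _ [the {linear M -> M} of idfun]); exists m.
Qed.

Lemma generated_by_quotient M G H (p : {linear G -> H}) :
  surjective p -> generated_by M G -> generated_by M H.
Proof.
move=> psurj [I [f fsurj]]; exists I, [the {linear _ -> H} of p \o f] => y.
by have [x <-] := psurj y; have [d <-] := fsurj x; exists d.
Qed.

End Generation.
Arguments trace {A} M N _.

(** * Simple subquotients and injectivity *)

Section CyclicSimple.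
Variable A : pzRingType.
Implicit Types M N G H : lmodType A.

(** This is simplicity of the submodule generated by [z], phrased inside [N] to avoid a separate
    module type: a nonzero submodule of it must contain [z]. *)
Definition cyclic_simple N (z : N) : Prop :=
  z != 0 /\ forall W : set N, submodule W -> W `<=` cyclic_submodule z ->
    W `<=` [set 0] \/ W z.

Lemma maximal_avoiding_ex G (L0 B : set G) (x : G) :
  submodule L0 -> L0 `<=` B -> ~ L0 x ->
  exists L : set G, [/\ submodule L, L0 `<=` L, L `<=` B, ~ L x &
    forall W, submodule W -> L `<=` W -> W `<=` B -> ~ W x -> W `<=` L].
Proof.
move=> L0sub L0B L0x.
(* [Zorn_bigcup] also asks for a bound on the empty chain, whose union is empty; letting [X] stand
   for the union of [L0] and [X] covers that case. *)
pose P (X : set G) :=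
  [/\ submodule (L0 `|` X), L0 `|` X `<=` B & ~ (L0 `|` X) x].
have [|X [[Xsub XB Xx] Xmax]] := @Zorn_bigcup G P.
  move=> F FP Ftot; split; last 2 first.
  - by move=> y [/L0B//|[X FX Xy]]; have [_ + _] := FP _ FX; apply; right.
  - by move=> [//|[X FX Xx]]; have [_ _] := FP _ FX; apply; right.
  - have F1 X : F X -> submodule (L0 `|` X) by move=> /FP[].
    apply/submoduleP; split; first by left; apply: submodule0.
    have lift X : F X -> L0 `|` X `<=` L0 `|` \bigcup_(X in F) X.
      by move=> FX z [|Xz]; [left | right; exists X].
    move=> a u v [L0u|[X FX Xu]] [L0v|[Y FY Yv]].
    + by left; apply: submoduleD => //; apply: submoduleZ.
    + apply: (lift Y FY); apply: (submoduleD (F1 _ FY)); last by right.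
      by apply: (submoduleZ (F1 _ FY)); left.
    + apply: (lift X FX); apply: (submoduleD (F1 _ FX)); last by left.
      by apply: (submoduleZ (F1 _ FX)); right.
    + have [XY|YX] := Ftot _ _ FX FY.
        apply: (lift Y FY); apply: (submoduleD (F1 _ FY)); last by right.
        by apply: (submoduleZ (F1 _ FY)); right; apply: XY.
      apply: (lift X FX); apply: (submoduleD (F1 _ FX)).
        by apply: (submoduleZ (F1 _ FX)); right.
      by right; apply: YX.
exists (L0 `|` X); split=> // W Wsub LW WB Wx.
apply: contrapT => /existsNP[w /not_implyP[Ww nXw]].
have LWE : L0 `|` W = W by apply/setUidPr => z L0z; apply: LW; left.
apply: (Xmax W); last by rewrite /P LWE.
split; first by move=> z Xz; apply: LW; right.
by move=> WX; apply: nXw; right; apply: WX.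
Qed.

(** Divide by a submodule [L] maximal among those between [L0] and [B] that avoid [x]. A submodule
    of the span of [p x] that misses [p x] pulls back, within [B], to one that contains [L] and
    avoids [x], hence equals [L]. *)
Lemma simple_quotient_ex G (L0 B : set G) (x : G) :
  submodule L0 -> submodule B -> L0 `<=` B -> B x -> ~ L0 x ->
  exists (H : lmodType A) (p : {linear G -> H}),
    [/\ surjective p, L0 `<=` p @^-1` [set 0], p @^-1` [set 0] `<=` B &
        cyclic_simple (p x)].
Proof.
move=> L0sub Bsub L0B Bx L0x.
have [L [Lsub L0L LB Lx Lmax]] := maximal_avoiding_ex L0sub L0B L0x.
have [H [p [psurj pE]]] := quotient_type Lsub.
exists H, p; split=> // [y /L0L/pE//|y /pE/LB//|].
split=> [|W Wsub Wp]; first by apply/eqP => /pE.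
pose V := B `&` p @^-1` W.
have Vsub : submodule V.
  have Psub := submodule_preimage p Wsub.
  apply/submoduleP; split; first by split; apply: submodule0.
  move=> a u v [Bu Pu] [Bv Pv].
  by split; apply: submoduleD => //; apply: submoduleZ.
have [Wx|nWx] := pselect (W (p x)); [by right | left].
have VL : V `<=` L.
  apply: Lmax => //; last 2 first.
  - by move=> y [].
  - by move=> [_].
  by move=> y Ly; split; [apply: LB | have /pE /= -> := Ly; apply: submodule0].
move=> w Ww; have [a _ aE] := Wp w Ww; rewrite -aE -linearZ.
apply/pE/VL; split; first exact: submoduleZ.
by rewrite -aE -linearZ in Ww.
Qed.

(** The span of [z] is a simple module, and it belongs to sigma[M] as a submodule of the generated
    module [H]; so it is [M]-injective. *)
Lemma co_semisimple_extend M H (K : lmodType A) (z : H) (eta : {linear K -> M})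
    (f : {linear K -> H}) :
  co_semisimple M -> generated_by M H -> cyclic_simple z -> injective eta ->
  range f `<=` cyclic_submodule z ->
  exists g : {linear M -> H}, range g `<=` cyclic_submodule z /\ g \o eta =1 f.
Proof.
move=> cosM genH [z0 zsimple] etainj fz.
have [Z [i [iinj iZ]]] := submodule_type (submodule_cyclic z).
have [|f' f'E] := @linear_factor _ _ _ _ i f iinj; first by rewrite iZ.
have Zsimple : simple_module Z.
  have [y _ yE] : range i z by rewrite iZ; apply: cyclic_gen.
  split; first by exists y; apply: contra_neq z0 => y0; rewrite -yE y0 linear0.
  move=> W Wsub.
  have [|W0|[y' Wy' y'E]] := zsimple _ (submodule_image i Wsub).
  - by rewrite -iZ; apply: image_subset.
  - left; apply/seteqP; split=> [w Ww|_ ->]; last exact: submodule0.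
    by apply: iinj; rewrite linear0; apply: W0; exists w.
  - right; apply/seteqP; split=> // w _.
    have [a _ aE] : cyclic_submodule z (i w) by rewrite -iZ; exists w.
    suff -> : w = a *: y' by apply: submoduleZ.
    by apply: iinj; rewrite linearZ y'E.
have [|g gE] := cosM Z Zsimple _ K eta f' etainj.
  exists H => //; exists (range i); last by exists i.
  by rewrite iZ; apply: submodule_cyclic.
exists [the {linear M -> H} of i \o g]; split=> [_ [m _ <-]|k /=].
  by rewrite -iZ; exists (g m).
by rewrite -f'E /=; congr (i _); apply: gE.
Qed.

(** Take a quotient [p] killing [L] in which [p m] spans a simple submodule. The quotient itself
    need not be simple, but [p], restricted to the preimage of that span, extends to a map [g] from
    [M] onto the span; its kernel is the maximal submodule. *)
Lemma maximal_submodule_sep M (L : set M) (m : M) :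
  co_semisimple M -> submodule L -> ~ L m ->
  exists P, [/\ maximal_submodule P, L `<=` P & ~ P m].
Proof.
move=> cosM Lsub Lm.
have [//|//|H [p [psurj Lp _ zsimple]]] :=
  simple_quotient_ex Lsub (submoduleT M) _ _ Lm.
have genH := generated_by_quotient psurj (generated_by_self M).
have Ksub := submodule_preimage p (submodule_cyclic (p m)).
have [K [i [iinj iK]]] := submodule_type Ksub.
have [|g [gz gE]] :=
    co_semisimple_extend (f := [the {linear K -> H} of p \o i])
      cosM genH zsimple iinj.
  move=> _ [k _ <-] /=.
  suff : range i (i k) by rewrite iK.
  by exists k.
have gpE x : cyclic_submodule (p m) (p x) -> g x = p x.
  by move=> zx; have [k _ <-] : range i x by [rewrite iK]; apply: gE.
have [z0 zmin] := zsimple.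
have gm : g m = p m by apply: gpE; apply: cyclic_gen.
exists (g @^-1` [set 0]); split; last 2 first.
- move=> x /Lp /= px; rewrite /preimage /= gpE ?px //.
  exact: submodule0 (submodule_cyclic _).
- by rewrite /preimage /= gm => /eqP; apply/negP.
split.
- exact/submodule_preimage/submodule_set0.
- move=> gT; move/eqP: z0; apply; rewrite -gm.
  by have : [set: M] m by []; rewrite -gT.
move=> W Wsub gW.
have [|gW0|[w Ww wE]] := zmin _ (submodule_image g Wsub).
- by move=> _ [w _ <-]; apply: gz; exists w.
- by left; apply/seteqP; split=> // w Ww; apply: gW0; exists w.
- right; apply/seteqP; split=> // y _.
  have [a _ aE] : cyclic_submodule (p m) (g y) by apply: gz; exists y.
  apply: (submodule_subl Wsub (y := a *: w)); last exact: submoduleZ.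
  by apply: gW; rewrite /preimage /= linearB linearZ /= wE aE subrr.
Qed.

(* Induction on a sum of ranges containing [z].  If [z] lies in [range u + U]
   but not in [U], then sending [m] to the unique [c] in [cyclic_submodule z]
   congruent to [u m] modulo [U] is a nonzero map on a submodule of [M]; it
   extends to [M] by injectivity. *)
Lemma nonzero_to_simple_ex M H (z : H) :
  co_semisimple M -> generated_by M H -> cyclic_simple z ->
  exists g : {linear M -> H}, range g `<=` cyclic_submodule z /\
    exists m, g m <> 0.
Proof.
move=> cosM genH zs; have [z0 zmin] := zs.
have [s] : trace M H z by rewrite ((generated_byP M H).1 genH).
elim: s => [/= zE|u s IHs]; first by rewrite zE eqxx in z0.
have [/IHs//|sz] := pselect (sum_ranges s z).
move=> [_ [m0 _ <-] [y0 sy0 zE]] {IHs}.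
have Usub := submodule_sum_ranges s; have Zsub := submodule_cyclic z.
set U := sum_ranges s in sz sy0 Usub; set Z := cyclic_submodule z in Zsub.
have ZU c : Z c -> U c -> c = 0.
  move=> Zc Uc.
  have [| |ZU0|[_ /sz//]] := zmin (Z `&` U).
  - apply/submoduleP; split; first by split; apply: submodule0.
    move=> a v w [? ?] [? ?].
    by split; apply: submoduleD => //; apply: submoduleZ.
  - by move=> w [].
  - exact: ZU0.
pose K := [set m | exists2 c, Z c & U (u m - c)].
have Ksub : submodule K.
  apply/submoduleP; split.
    exists 0; first exact: submodule0 Zsub.
    by rewrite linear0 subrr; apply: submodule0 Usub.
  move=> a v w [c Zc Uc] [d Zd Ud]; exists (a *: c + d).
    by apply: submoduleD => //; apply: submoduleZ.
  rewrite linearP opprD addrACA -scalerBr.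
  by apply: submoduleD => //; apply: submoduleZ.
have [K' [i [iinj iK]]] := submodule_type Ksub.
have /choice[f fP] : forall k, exists c, Z c /\ U (u (i k) - c).
  move=> k; have : range i (i k) by exists k.
  by rewrite iK => -[c Zc Uc]; exists c.
have funiq m c d : Z c -> Z d -> U (u m - c) -> U (u m - d) -> c = d.
  move=> Zc Zd Uc Ud; apply/subr0_eq/ZU; first exact: submoduleB.
  have -> : c - d = (u m - d) - (u m - c).
    by rewrite opprB [RHS]addrC addrA subrK.
  exact: submoduleB.
have [|f' f'E] := @linear_ex A K' H f.
  move=> a v w; have [Zf Uf] := fP (a *: v + w).
  have [Zv Uv] := fP v; have [Zw Uw] := fP w.
  apply: (funiq _ _ _ Zf _ Uf).
    by apply: submoduleD => //; apply: submoduleZ.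
  rewrite (linearP i) /= (linearP u) /= opprD addrACA -scalerBr.
  by apply: submoduleD => //; apply: submoduleZ.
have [|g [gz gE]] := co_semisimple_extend (f := f') cosM genH zs iinj.
  by move=> _ [k _ <-]; rewrite f'E; case: (fP k).
exists g; split=> //; exists m0.
have Um0 : U (u m0 - z).
  by rewrite -zE opprD addrA subrr sub0r; apply: submoduleN.
have [k _ kE] : range i m0 by rewrite iK; exists z => //; apply: cyclic_gen.
rewrite -kE (gE k : g (i k) = _) f'E => fk0; have [_] := fP k.
rewrite fk0 kE subr0 => Uum; apply: sz.
by rewrite -zE; apply: submoduleD.
Qed.

End CyclicSimple.

(** * Lifting maps out of a quasi-projective module *)

Section Projectivity.
Variables (A : pzRingType) (M : lmodType A).
Hypothesis Mqp : quasi_projective M.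

(** Corestricting both maps to the range of [p] makes [p] surjective. *)
Lemma quasi_projective_lift (N : lmodType A) (p f : {linear M -> N}) :
  range f `<=` range p -> exists g : {linear M -> M}, p \o g =1 f.
Proof.
move=> fp.
have [X [i [iinj iX]]] := submodule_type (submodule_image p (submoduleT M)).
have [|p' p'E] := @linear_factor _ _ _ _ i p iinj; first by rewrite iX.
have [|f' f'E] := @linear_factor _ _ _ _ i f iinj; first by rewrite iX.
have [|g gE] := Mqp (p := p') f'.
  move=> y; have [m _ mE] : range p (i y) by rewrite -iX; exists y.
  by exists m; apply: iinj; rewrite -mE -p'E.
by exists g => m; rewrite /= -p'E -f'E /=; congr (i _); apply: gE.
Qed.

(** Induction on the number of images: modulo the image of [p \o u] the remaining maps suffice for a
    lift [h']. The error [f - p h'] then takes values in that image and lifts through [p \o u]. *)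
Lemma quasi_projective_lift_sum (G H : lmodType A) (s : seq {linear M -> G})
    (p : {linear G -> H}) (f : {linear M -> H}) :
  range f `<=` p @` sum_ranges s -> exists h : {linear M -> G}, p \o h =1 f.
Proof.
elim: s H p f => [|u s IHs] H p f fp.
  exists [the {linear M -> G} of \0] => m /=; rewrite linear0.
  by have [|_ -> <-] := fp (f m); [exists m | rewrite linear0].
pose pu : {linear M -> H} := [the {linear M -> H} of p \o u].
have [H' [r [rsurj rE]]] := quotient_type (submodule_image pu (submoduleT M)).
have [|h' h'E] := IHs H' [the {linear G -> H'} of r \o p]
    [the {linear M -> H'} of r \o f].
  move=> _ [m _ <-] /=.
  have [|_ [_ [m1 _ <-] [y sy <-]] <-] := fp (f m); first by exists m.
  exists y => //=; rewrite !linearD /= [X in X + _](_ : _ = 0) ?add0r //.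
  by apply/rE; exists m1.
pose d : {linear M -> H} :=
  [the {linear M -> H} of f \- [the {linear M -> H} of p \o h']].
have [|g gE] := @quasi_projective_lift H pu d.
  move=> _ [m _ <-]; apply/rE; rewrite /= linearB /=.
  by rewrite (h'E m : r (p (h' m)) = r (f m)) subrr.
exists [the {linear M -> G} of [the {linear M -> G} of u \o g] \+ h'] => m /=.
by rewrite linearD (gE m : p (u (g m)) = f m - p (h' m)) subrK.
Qed.

Lemma co_semisimple_generator : co_semisimple M -> generator_of_sigma M.
Proof.
move=> cosM N [G genG [_ _ [j [jinj _]]]].
apply/generated_byP/seteqP; split=> // n _; apply: contrapT => Tn.
have jTsub := submodule_image j (submodule_trace M N).
have jNsub := submodule_image j (submoduleT N).
(* The subquotient of [N] is taken inside [G], because lifting needs a module known to be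
   [M]-generated. *)
have [||| H [p [psurj Tp pj zs]]] := simple_quotient_ex jTsub jNsub (x := j n).
- by move=> _ [y _ <-]; exists y.
- by exists n.
- by move=> [y Ty /jinj yn]; apply: Tn; rewrite -yn.
have genH := generated_by_quotient psurj genG.
have [f [fz [m fm]]] := nonzero_to_simple_ex cosM genH zs.
(* Finitely many images already contain [j n], hence all its multiples, and these cover the range of
   [f]. *)
have [s sn] : trace M G (j n) by rewrite ((generated_byP M G).1 genG).
have ssub := submodule_sum_ranges s.
have [|h hE] := @quasi_projective_lift_sum G H s p f.
  move=> y /fz[a _ <-]; exists (a *: j n); first exact: submoduleZ.
  by rewrite linearZ.
(* Each [h x] differs from a multiple of [j n] by an element of the kernel of [p], which lies in the
   image of [j]; so [h] factors through [N]. *)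
have [|h' h'E] := @linear_factor _ _ _ _ j h jinj.
  move=> _ [x _ <-]; have [|a _ aE] := fz (f x); first by exists x.
  apply: (submodule_subl jNsub (y := a *: j n)); last first.
    by apply: submoduleZ => //; exists n.
  apply: pj; rewrite /preimage /= linearB linearZ /= aE.
  by rewrite (hE x : p (h x) = f x) subrr.
apply: fm; rewrite -hE /= -h'E /=; apply: Tp; exists (h' m) => //.
by apply: (range_trace (u := h')); exists m.
Qed.

End Projectivity.

(** * Idempotent endomorphisms and direct summands *)

Section EndomorphismRing.
Variables (A : pzRingType) (M : lmodType A).
Implicit Types e f : {linear M -> M}.

Lemma abelian_endoP : abelian_ring (endo M) <->
  forall e (x : {linear M -> M}), (forall m, e (e m) = e m) ->
    forall m, e (x m) = x (e m).
Proof.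
split=> [ab e x ee m|ab e ee x].
  have /(ab (e : endo M))/(_ x) ex : (e : endo M) * e = e by apply: endoP.
  exact: (congr1 (fun g : {linear M -> M} => g m) ex).
apply: endoP => m; apply: ab => {}m.
exact: (congr1 (fun g : {linear M -> M} => g m) ee).
Qed.

Lemma regular_endoP : von_neumann_regular (endo M) <->
  forall f, exists x : {linear M -> M}, forall m, f (x (f m)) = f m.
Proof.
split=> reg f; have [x fxf] := reg f; exists x.
  by move=> m; apply: (congr1 (fun g : {linear M -> M} => g m) fxf).
by apply: endoP => m; apply: fxf.
Qed.

(** Range and kernel of an idempotent [e] are fully invariant: the first gives [e x e = x e], the
    second [e x (1 - e) = 0]. *)
Lemma duo_abelian : duo M -> abelian_ring (endo M).
Proof.
move=> Mduo; apply/abelian_endoP => e x ee m.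
have [||m' _ m'E] := Mduo (range e) _ x (x (e m)).
- exact/submodule_image/submoduleT.
- by exists (e m) => //; exists m.
have kersub := submodule_preimage e (submodule_set0 M).
have : e (x (m - e m)) = 0.
  apply: (Mduo _ kersub x); exists (m - e m) => //.
  by rewrite /preimage /= linearB /= ee subrr.
by rewrite !linearB /= -m'E ee => /subr0_eq.
Qed.

Lemma direct_summand_proj (N : set M) : direct_summand N ->
  exists e, (forall m, e (e m) = e m) /\ range e = N.
Proof.
move=> [Nsub [H [Hsub NH NHT]]].
have uniq m x y : N x -> N y -> H (m - x) -> H (m - y) -> x = y.
  move=> Nx Ny Hx Hy; apply/subr0_eq.
  suff : [set 0] (x - y) by [].
  rewrite -NH; split; first exact: submoduleB.
  have -> : x - y = (m - y) - (m - x) by rewrite opprB [RHS]addrC addrA subrK.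
  exact: submoduleB.
have /choice[e eP] : forall m, exists x, N x /\ H (m - x).
  move=> m; have : [set: M] m by [].
  by rewrite -NHT => -[x Nx [y Hy <-]]; exists x; rewrite addrAC subrr add0r.
have eN x : N x -> e x = x.
  move=> Nx; have [Ne He] := eP x; apply: (uniq x) => //.
  by rewrite subrr; apply: submodule0.
have [|e' e'E] := @linear_ex A M M e.
  move=> a x y; have [Ne He] := eP (a *: x + y).
  have [Nx Hx] := eP x; have [Ny Hy] := eP y.
  apply: (uniq _ _ _ Ne _ He).
    by apply: submoduleD => //; apply: submoduleZ.
  rewrite opprD addrACA -scalerBr.
  by apply: submoduleD => //; apply: submoduleZ.
exists e'; split=> [m|]; first by rewrite !e'E eN //; case: (eP m).
apply/seteqP; split=> [_ [m _ <-]|x Nx]; first by rewrite e'E; case: (eP m).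
by exists x; rewrite // e'E eN.
Qed.

Lemma range_proj_summand e :
  (forall m, e (e m) = e m) -> direct_summand (range e).
Proof.
move=> ee; split; first exact/submodule_image/submoduleT.
exists (e @^-1` [set 0]); split.
- exact/submodule_preimage/submodule_set0.
- apply/seteqP; split=> [_ [[m _ <-]] /=|_ ->].
    by rewrite /preimage /= ee.
  by split; [exists 0; rewrite ?linear0 | rewrite /preimage /= linear0].
- apply/seteqP; split=> // m _; exists (e m); first by exists m.
  exists (m - e m); rewrite /preimage /=.
    by rewrite linearB /= ee subrr.
  by rewrite addrC subrK.
Qed.

(* In an abelian regular ring a finite sum of images [e_i M] is again the image
   of an idempotent, since [e1 M + e2 M = (e1 + e2 - e1 e2) M]. *)
Lemma sum_ranges_proj (s : seq {linear M -> M}) : abelian_endoregular M ->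
  exists e, (forall m, e (e m) = e m) /\ range e = sum_ranges s.
Proof.
move=> [/regular_endoP reg /abelian_endoP ab].
elim: s => [|u s [e2 [e2e2 e2E]]] /=.
  exists [the {linear M -> M} of \0]; split=> //.
  by apply/seteqP; split=> [_ [m _ <-]|_ ->] //; exists 0.
(* By regularity [u x] is an idempotent with the same image as [u]. *)
have [x uxu] := reg u.
have [e1 e1E] : exists e1, forall m, e1 m = u (x m).
  by exists [the {linear M -> M} of u \o x].
have e1u m : e1 (u m) = u m by rewrite e1E uxu.
have e1e1 m : e1 (e1 m) = e1 m by rewrite [e1 m]e1E e1u.
have e12 m : e1 (e2 m) = e2 (e1 m) by apply: ab.
have [e eE] : exists e, forall m, e m = e1 m + e2 (m - e1 m).
  by exists [the {linear M -> M} of e1 \+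
    [the {linear M -> M} of e2 \o [the {linear M -> M} of idfun \- e1]]].
have ee1 m : e (e1 m) = e1 m by rewrite eE e1e1 subrr linear0 addr0.
have ee2 m : e (e2 m) = e2 m.
  by rewrite eE linearB /= e2e2 -e12 e2e2 addrC subrK.
exists e; split=> [m|].
  by rewrite [e m]eE (linearD e) /= ee1 ee2.
rewrite -e2E; apply/seteqP.
split=> [_ [m _ <-]|_ [_ [m _ <-] [_ [m' _ <-] <-]]].
  rewrite eE; exists (e1 m); first by exists (x m); rewrite // e1E.
  by exists (e2 (m - e1 m)) => //; exists (m - e1 m).
by exists (u m + e2 m'); rewrite // linearD /= -(e1u m) ee1 ee2.
Qed.

End EndomorphismRing.

(** * The implications between the three conditions *)

Section Conditions.
Variables (A : pzRingType) (M : lmodType A).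

(** The cyclic submodule belongs to sigma[M], so [m] lies in a finite sum of images of maps from [M]
    into it. That sum is therefore the whole cyclic submodule, and [sum_ranges_proj] makes it the
    image of an idempotent. *)
Lemma abelian_endoregular_cyclic : abelian_endoregular M ->
  generator_of_sigma M -> forall m : M, exists e : {linear M -> M},
    (forall x, e (e x) = e x) /\ range e = cyclic_submodule m.
Proof.
move=> aM genM m.
have [X [i [iinj iX]]] := submodule_type (submodule_cyclic m).
have /genM/generated_byP TX : in_sigma M X.
  exists M; first exact: generated_by_self.
  exists (range i); last by exists i.
  by rewrite iX; apply: submodule_cyclic.
have [y _ yE] : range i m by rewrite iX; apply: cyclic_gen.
have [s sy] : trace M X y by rewrite TX.
have [e [ee eE]] := sum_ranges_proj
  [seq [the {linear M -> M} of i \o u] | u : {linear M -> X} <- s] aM.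
exists e; split=> //; rewrite eE sum_ranges_comp.
apply/seteqP; split; first by rewrite -iX; apply: image_subset.
apply: cyclic_subset; last by exists y.
exact/submodule_image/submodule_sum_ranges.
Qed.

(** If the idempotent [e] projects onto the span of [x], centrality gives [f x = f (e x) = e (f x)],
    which lies in that span. *)
Lemma abelian_endoregular_duo : abelian_endoregular M ->
  generator_of_sigma M -> duo M.
Proof.
move=> aM genM N Nsub f _ [x Nx <-].
have [e [ee eE]] := abelian_endoregular_cyclic aM genM x.
have [m _ mx] : range e x by rewrite eE; apply: cyclic_gen.
have [_ /abelian_endoP ab] := aM.
apply: (cyclic_subset Nsub Nx); rewrite -eE; exists (f x) => //.
by rewrite ab // -mx ee.
Qed.

Lemma co_semisimple_quasi_duo_duo : co_semisimple M -> quasi_duo M -> duo M.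
Proof.
move=> cosM qdM N Nsub f _ [x Nx <-]; apply: contrapT => Nfx.
have [P [Pmax NP Pfx]] := maximal_submodule_sep cosM Nsub Nfx.
by apply: Pfx; apply: (qdM P Pmax f); exists x => //; apply: NP.
Qed.

(* For [P] maximal and fully invariant, the preimage of [P] under [f] contains
   [P], so it is [P] or [M]. *)
Lemma square_mem (f : {linear M -> M}) (L : set M) y :
  co_semisimple M -> quasi_duo M -> submodule L -> L (f (f y)) -> L (f y).
Proof.
move=> cosM qdM Lsub Lffy; apply: contrapT => Lfy.
have [P [Pmax LP Pfy]] := maximal_submodule_sep cosM Lsub Lfy.
have [Psub _ Pmx] := Pmax; apply: Pfy.
have [||fP|fP] := Pmx (f @^-1` P).
- exact: submodule_preimage.
- by move=> x Px; apply: (qdM P Pmax f); exists x.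
- by rewrite -fP; apply: LP.
- by have : [set: M] y by []; rewrite -fP.
Qed.

(** [square_mem] serves twice: with the range of [f f] it allows a lift [g] with [f f g = f]; with
    the zero submodule it cancels the outer [f] in [f (f g f) = f f]. *)
Lemma co_semisimple_quasi_duo_regular : quasi_projective M ->
  co_semisimple M -> quasi_duo M -> von_neumann_regular (endo M).
Proof.
move=> Mqp cosM qdM; apply/regular_endoP => f.
pose ff : {linear M -> M} := [the {linear M -> M} of f \o f].
have [|g gE] := @quasi_projective_lift A M Mqp M ff f.
  have ffsub := submodule_image ff (submoduleT M).
  by move=> _ [m _ <-]; apply: (square_mem cosM qdM ffsub); exists m.
exists g => m; apply/subr0_eq; rewrite -linearB.
apply: (square_mem (L := [set 0])) => //; first exact: submodule_set0.
by rewrite /= !linearB /= (gE (f m) : f (f (g (f m))) = _) subrr.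
Qed.

Lemma duo_summand_co_semisimple : quasi_projective M -> duo M ->
  (forall m : M, direct_summand (cyclic_submodule m)) -> co_semisimple M.
Proof.
move=> Mqp Mduo Msum N [_ Nsimple] _ K eta f etainj.
have /abelian_endoP ab := duo_abelian Mduo.
(* Here [e'] is [e] with values in [K], so that [f] can be composed with it. *)
have proj k : exists (e : {linear M -> M}) (e' : {linear M -> K}),
    [/\ forall m, e (e m) = e m, forall m, eta (e' m) = e m & e' (eta k) = k].
  have [e [ee eE]] := direct_summand_proj (Msum (eta k)).
  have [|e' e'E] := @linear_factor _ _ _ _ eta e etainj.
    by rewrite eE => _ [a _ <-]; exists (a *: k); rewrite ?linearZ.
  have {}e'E m : eta (e' m) = e m := e'E m.
  exists e, e'; split=> //; apply: etainj; rewrite e'E.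
  have [m _ <-] : range e (eta k) by rewrite eE; apply: cyclic_gen.
  exact: ee.
have [[k fk]|f0] := pselect (exists k, f k <> 0); last first.
  exists [the {linear M -> N} of \0] => k /=; apply: contrapT => fk.
  by apply: f0; exists k => fk0; apply: fk.
have [e [e' [ee e'E e'k]]] := proj k.
exists [the {linear M -> N} of f \o e'] => k' /=; apply: contrapT => fk'.
(* The part of [k'] outside the summand: [e] kills [eta k''], while [f k''] measures the failure of
   the extension. *)
pose k'' := k' - e' (eta k').
have fk'' : f k'' <> 0 by rewrite linearB => /subr0_eq/esym.
have [d [d' [_ _ d'k]]] := proj k''.
(* The map [f \o e'] is nonzero at [eta k], hence onto the simple module [N], so [f \o d'] lifts
   through it. *)
have [|h hE] := Mqp N [the {linear M -> N} of f \o e']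
    [the {linear M -> N} of f \o d'].
  pose p : {linear M -> N} := [the {linear M -> N} of f \o e'].
  have [pR|pR] := Nsimple _ (submodule_image p (submoduleT M)); last first.
    by move=> y; have [m _ <-] : range p y by [rewrite pR]; exists m.
  case: fk; have : range p (f k) by exists (eta k) => //=; rewrite e'k.
  by rewrite pR.
apply: fk''; rewrite -d'k -(hE (eta k'') : f (e' _) = f (d' _)).
suff -> : e' (h (eta k'')) = 0 by rewrite linear0.
apply: etainj; rewrite linear0 e'E (ab e h ee).
by rewrite linearB linearB /= e'E ee subrr linear0.
Qed.

End Conditions.

Theorem proposition3p9 (R : pzRingType) (M : rmodType R)
  (Mfg : finitely_generated M) (Mqp : quasi_projective M) :
  ((abelian_endoregular M /\ generator_of_sigma M) <->
   (co_semisimple M /\ quasi_duo M)) /\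
  ((co_semisimple M /\ quasi_duo M) <->
   [/\ duo M, generator_of_sigma M &
       forall m : M, direct_summand (cyclic_submodule m)]).
Proof.
have ac : abelian_endoregular M /\ generator_of_sigma M ->
    [/\ duo M, generator_of_sigma M &
        forall m : M, direct_summand (cyclic_submodule m)].
  move=> [aM genM]; split=> // [|m]; first exact: abelian_endoregular_duo.
  have [e [ee <-]] := abelian_endoregular_cyclic aM genM m.
  exact: range_proj_summand.
have cb : [/\ duo M, generator_of_sigma M &
      forall m : M, direct_summand (cyclic_submodule m)] ->
    co_semisimple M /\ quasi_duo M.
  move=> [Mduo _ Msum]; split; first exact: duo_summand_co_semisimple.
  by move=> N [Nsub _ _]; apply: Mduo.
have ba : co_semisimple M /\ quasi_duo M ->
    abelian_endoregular M /\ generator_of_sigma M.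
  move=> [cosM qdM]; split; last exact: co_semisimple_generator.
  split; first exact: co_semisimple_quasi_duo_regular.
  by apply: duo_abelian; apply: co_semisimple_quasi_duo_duo.
by split; [split=> [/ac/cb|/ba] | split=> [/ba/ac|/cb]].
Qed.
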